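(* Let $d\ge4$. For every integer $s$ with $1\le s<d-1$ there is a one-variable polynomial $B_d^{(s)}$ such that for all integers $m,n\ge1$ with $\min(m,n)=s$ and $\max(m,n)\ge d-1$, $$E_d(m,n)-p_d(m,n)=B_d^{(s)}\big(\max(m,n)\big).$$ That is, whenever exactly one of $m,n$ is below $d-1$, the count $E_d(m,n)$ differs from $p_d(m,n)$ by a polynomial in the larger variable that is determined by $\min(m,n)$.
   Context: $G_{m,n}$ is the $m\times n$ grid graph with cells $(i,j)$, $1\le i\le m$, $1\le j\le n$, two cells adjacent when they differ by one in a single coordinate. A height function on $G_{m,n}$ is a map $h\colon G_{m,n}\to\mathbb{Z}$ with $|h(u)-h(v)|=1$ on every edge $uv$ and $h(1,1)=0$. A cell is a strict local minimum (maximum) if every neighbour has value larger (smaller) by one; the extrema are the strict local minima and maxima. $E_d(m,n)$ is the number of height functions on $G_{m,n}$ with exactly $d$ extrema. For each $d\ge2$, $p_d(m,n)$ denotes the (unique, symmetric) bivariate polynomial that agrees with $E_d(m,n)$ for all $m,n\ge\max(d-1,2)$; such a polynomial exists. *)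

(* Defs.v *)
From mathcomp Require Import all_boot all_order all_algebra finmap.
From mathcomp Require Import boolp classical_sets functions cardinality.
From mathcomp Require Import zify.

Set Implicit Arguments.
Unset Strict Implicit.
Unset Printing Implicit Defensive.

Import Order.TTheory GRing.Theory Num.Theory.

Local Open Scope classical_set_scope.
Local Open Scope ring_scope.

(* Cells are indexed from 0: the cell (i, j) of the grid with 1 <= i <= m and
   1 <= j <= n is (i - 1, j - 1) : cell m n. *)
Definition cell (m n : nat) : finType := ('I_m * 'I_n)%type.

Definition adjacent (m n : nat) (u v : cell m n) : bool :=
  ((u.1 == v.1) && (`|u.2 - v.2|%N == 1%N)) ||
  ((u.2 == v.2) && (`|u.1 - v.1|%N == 1%N)).

(* The last condition is h(1,1) = 0, stated so that it makes sense without
   assuming m, n >= 1. *)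
Definition is_height (m n : nat) (h : {ffun cell m n -> int}) : Prop :=
  (forall u v : cell m n, adjacent u v -> `|h u - h v| = 1) /\
  (forall u : cell m n, u.1 = 0%N :> nat -> u.2 = 0%N :> nat -> h u = 0).

Definition strict_local_min (m n : nat) (h : {ffun cell m n -> int})
    (u : cell m n) : bool :=
  [forall v : cell m n, adjacent u v ==> (h v == h u + 1)].

Definition strict_local_max (m n : nat) (h : {ffun cell m n -> int})
    (u : cell m n) : bool :=
  [forall v : cell m n, adjacent u v ==> (h v == h u - 1)].

Definition extrema (m n : nat) (h : {ffun cell m n -> int}) : {set cell m n} :=
  [set u | strict_local_min h u || strict_local_max h u]%SET.

Lemma is_height_bound (m n : nat) (h : {ffun cell m n -> int}) (u : cell m n) :
  is_height h -> `|h u| <= (u.1 + u.2)%N%:Z.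
Proof.
move=> [hadj h0]; case: u => -[i im] [j jn] /=.
elim: i im => [|i IHi] im.
  elim: j jn => [|j IHj] jn; first by rewrite h0.
  have jn' : (j < n)%N by lia.
  have := IHj jn'.
  have := hadj (Ordinal im, Ordinal jn) (Ordinal im, Ordinal jn').
  have -> : adjacent (Ordinal im, Ordinal jn) (Ordinal im, Ordinal jn').
    by apply/orP; left; apply/andP; split; [exact: eqxx | rewrite /=; lia].
  by move=> /(_ isT) /=; move: (h _) (h _) => a b; lia.
have im' : (i < m)%N by lia.
have := IHi im'.
have := hadj (Ordinal im, Ordinal jn) (Ordinal im', Ordinal jn).
have -> : adjacent (Ordinal im, Ordinal jn) (Ordinal im', Ordinal jn).
  by apply/orP; right; apply/andP; split; [exact: eqxx | rewrite /=; lia].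
by move=> /(_ isT) /=; move: (h _) (h _) => a b; lia.
Qed.

Lemma finite_heights (m n : nat) : finite_set [set h | @is_height m n h].
Proof.
pose K := (m + n)%N.
pose g (f : {ffun cell m n -> 'I_(K + K).+1}) : {ffun cell m n -> int} :=
  [ffun u => (f u : nat)%:Z - K%:Z].
apply: (@sub_finite_set _ _ (g @` setT)); last exact: finite_image.
move=> h hh /=.
exists [ffun u => inord (absz (h u + K%:Z))] => //.
apply/ffunP => u; rewrite !ffunE.
have leK : `|h u| <= K%:Z.
  apply: le_trans (is_height_bound u hh) _.
  by rewrite lez_nat leq_add // ltnW.
move: leK; set a : int := h u => leK.
rewrite inordK; lia.
Qed.

(* fset_set of an infinite set is empty; by finite_heights this junk value is
   never used here. *)
Definition E (d m n : nat) : nat :=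
  #|` fset_set [set h : {ffun cell m n -> int}
                 | is_height h /\ #|extrema h| = d] |.

(* p is the polynomial p_d.  Agreement on this infinite product of ranges
   determines p, and since E d m n = E d n m it forces p to be symmetric. *)
Definition is_p (d : nat) (p : {poly {poly rat}}) : Prop :=
  forall m n : nat, (maxn d.-1 2 <= m)%N -> (maxn d.-1 2 <= n)%N ->
    p.[m%:R, n%:R] = (E d m n)%:R.

(* Main.v *)
Require Import Defs.
From mathcomp Require Import all_boot all_order all_algebra.
From mathcomp Require Import finmap boolp classical_sets cardinality.
From mathcomp Require Import zify ring.

(** The point is that E_d(s, N), for fixed s >= 1 and d >= 3, is a polynomial
in N on the whole range N >= d - 1 ([E_polynomial]).  Since E_d and p_d are
symmetric, B is then this polynomial minus p_d(s, N).

To see that E_d(s, N) is a polynomial, read a height function on an s x N grid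
as a sequence of columns, each one obtained from the preceding one by adding a
vector e of signs.  Everything rests on a climbing argument
([extremal_exists]): if in some row a column exceeds all its side columns, then
going up along that column through such cells ends at a local maximum of the
height function.  Hence:
 - a first or last column contains an extremum, and at least two of them if the
   signs towards its only side column are not all equal
   ([side_count_nonconstant]);
 - an interior column without extrema has equal sign vectors on both sides, and
   they are constant: the three columns are translates of each other
   ([interior_count_gt0]).

So columns without extrema come in blocks of translates, and only the lengths
of these blocks grow with N.  To count, fix two consecutive columns c and c + e
and let f_r(k) be the number of ways to append k columns such that c + e and
the appended columns contain r extrema ([continuations]).  Appending a column
expresses f_r(k + 1) as a sum of functions of the same kind with smaller r,
plus f_r(k) itself when e is constant, because translating the columns does
not change the count.  If e is not constant, polynomiality is inherited with a
shift by one; if e is constant, f_r is a discrete antiderivative of a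
polynomial.  Induction on r shows that f_r is a polynomial for k >= r - 1, and
for k >= r - 2 if e is constant ([continuations_polynomial]).

The bound d - 1 comes out as follows.  The first column uses up at least one
extremum, and at least two if the first sign vector is not constant; in both
cases the remaining count is polynomial as soon as k = N - 2 >= d - 3. *)

Set Implicit Arguments.
Unset Strict Implicit.
Unset Printing Implicit Defensive.

Import Order.TTheory GRing.Theory Num.Theory.
Local Open Scope ring_scope.

(** * Polynomials on a half-line *)

Definition polynomial_from (a : nat) (f : nat -> nat) : Prop :=
  exists P : {poly rat}, forall n, (a <= n)%N -> (f n)%:R = P.[n%:R].

Lemma polynomial_from_le a b f :
  (a <= b)%N -> polynomial_from a f -> polynomial_from b f.
Proof.
by move=> ab [P hP]; exists P => n bn; apply: hP; exact: leq_trans bn.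
Qed.

Lemma polynomial_from0 a f : (forall n, f n = 0%N) -> polynomial_from a f.
Proof. by move=> f0; exists 0 => n _; rewrite f0 horner0. Qed.

Lemma polynomial_from_sum a (I : finType) (C : pred I) (F : I -> nat -> nat) :
  (forall i, C i -> polynomial_from a (F i)) ->
  polynomial_from a (fun n => \sum_(i | C i) F i n)%N.
Proof.
move=> hF.
have {}hF i : exists P : {poly rat},
    C i -> forall n, (a <= n)%N -> (F i n)%:R = P.[n%:R].
  case: (boolP (C i)) => [/hF [P hP]|_]; first by exists P.
  by exists 0.
have [P hP] := choice hF.
exists (\sum_(i | C i) P i) => n an.
by rewrite natr_sum horner_sum; apply: eq_bigr => i Ci; apply: hP.
Qed.

Lemma polynomial_from_shift a f g :
  (forall n, f n.+1 = g n) -> polynomial_from a g -> polynomial_from a.+1 f.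
Proof.
move=> fg [P hP]; exists (P \Po ('X - 1%:P)) => -[//|n] an.
by rewrite fg hP // horner_comp !hornerE -natr1 addrK.
Qed.

(** The operator D is linear and D ('X^(n+1)) is (n+1) *: 'X^n plus monomials
of lower degree, so every monomial is reached by induction on its degree. *)
Lemma poly_antidifference (q : {poly rat}) :
  exists P : {poly rat}, P \Po ('X + 1%:P) - P = q.
Proof.
pose D (P : {poly rat}) := P \Po ('X + 1%:P) - P.
have DD P Q : D (P + Q) = D P + D Q by rewrite /D comp_polyD opprD addrACA.
have DZ a P : D (a *: P) = a *: D P by rewrite /D comp_polyZ scalerBr.
have Dsum n (F : 'I_n -> {poly rat}) :
    (forall i, exists P, D P = F i) -> exists P, D P = \sum_i F i.
  move=> /choice [P hP]; exists (\sum_i P i).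
  rewrite (big_morph D DD (_ : D 0 = 0)); first exact: eq_bigr.
  by rewrite /D comp_poly0 subrr.
have DX n : exists P, D P = 'X^n.
  elim/ltn_ind: n => n IH.
  have [Q hQ] : exists Q, D Q = \sum_(i < n) 'X^i *+ 'C(n.+1, i).
    apply: Dsum => i; have [P hP] := IH i (ltn_ord i).
    by exists ('C(n.+1, i)%:R *: P); rewrite DZ hP scaler_nat.
  exists (n.+1%:R^-1 *: ('X^(n.+1) + (-1) *: Q)).
  have {}hQ : D ('X^(n.+1) + (-1) *: Q) = n.+1%:R *: 'X^n.
    rewrite DD DZ hQ scaleN1r /D comp_Xn_poly [_ + 1%:P]addrC exprDn.
    under eq_bigr => i _ do rewrite expr1n mul1r.
    rewrite !big_ord_recr /= binn binSn mulr1n addrK scaler_nat.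
    by rewrite addrAC subrr add0r.
  rewrite DZ hQ.
  by rewrite scalerA mulVf ?scale1r // pnatr_eq0.
rewrite -[q]coefK poly_def; apply: Dsum => i.
by have [P hP] := DX i; exists (q`_i *: P); rewrite DZ hP.
Qed.

Lemma polynomial_from_antidifference a f g :
  (forall n, f n.+1 = f n + g n)%N -> polynomial_from a g ->
  polynomial_from a f.
Proof.
move=> fg [q hq]; have [P hP] := poly_antidifference q.
exists (P + ((f a)%:R - P.[a%:R])%:P) => n an.
rewrite -(subnK an); elim: (n - a)%N => [|k IH].
  by rewrite add0n hornerD hornerC addrC subrK.
rewrite addSn fg natrD IH hq ?leq_addl // -hP.
rewrite !(hornerD, hornerN, hornerC, hornerX, horner_comp).
rewrite -[(k + a).+1%:R]natr1; ring.
Qed.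

(** * Columns and their extrema *)

Definition column (s : nat) := {ffun 'I_s.+1 -> int}.
Definition signs (s : nat) := {ffun 'I_s.+1 -> bool}.

Definition sg (b : bool) : int := if b then 1 else -1.

Definition step s (c : column s) (e : signs s) : column s :=
  [ffun i => c i + sg (e i)].

Definition constant_signs s (e : signs s) : bool := e == [ffun=> e ord0].

Definition height_column s (c : column s) : bool :=
  [forall i : 'I_s.+1, forall j : 'I_s.+1,
     (`|(i : nat) - (j : nat)|%N == 1%N) ==> (`|c i - c j| == 1)].

(** The sign [b] treats maxima ([true]) and minima ([false]) at once.  The list
[nb] holds the side columns that exist: two for an interior column, one at
either end of the grid, none if the grid is a single column. *)
Definition extremal s (b : bool) (nb : seq (column s)) (c : column s)
    (i : 'I_s.+1) : bool :=
  [forall j : 'I_s.+1,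
     (`|(i : nat) - (j : nat)|%N == 1%N) ==> (c j == c i - sg b)]
  && all (fun a : column s => a i == c i - sg b) nb.

Definition extrema_count s (nb : seq (column s)) (c : column s) : nat :=
  #|[set i | extremal true nb c i || extremal false nb c i]%SET|.

Lemma height_columnP s (c : column s) :
  reflect (forall i j : 'I_s.+1,
             `|(i : nat) - (j : nat)|%N = 1%N -> `|c i - c j| = 1)
    (height_column c).
Proof.
apply: (iffP forallP) => [h i j ij|h i].
  by apply/eqP; move/forallP: (h i) => /(_ j) /implyP; apply; apply/eqP.
by apply/forallP => j; apply/implyP => /eqP ij; apply/eqP/h.
Qed.

Definition compatible s (a c : column s) : Prop :=
  height_column a /\ forall i, `|a i - c i| = 1.

Lemma compatible_step s (c : column s) e :
  height_column c -> compatible c (step c e).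
Proof. by split=> // i; rewrite ffunE; case: (e i); rewrite /sg; lia. Qed.

Lemma compatible_step_r s (c : column s) e : height_column (step c e) ->
  compatible (step c e) c.
Proof. by split=> // i; rewrite ffunE; case: (e i); rewrite /sg; lia. Qed.

(** The climbing argument, for [b = true].  Among the rows in which [c] exceeds
all its side columns, take one where [c] is largest.  If a vertical neighbour
were higher, then the side columns, which change by one and differ from [c] by
one, would be forced to lie below [c] there as well, against maximality. *)
Lemma extremal_exists {s} b (nb : seq (column s)) (c : column s) i0 :
  height_column c -> (forall a, a \in nb -> compatible a c) ->
  (forall a : column s, a \in nb -> a i0 = c i0 - sg b) ->
  exists i, extremal b nb c i.
Proof.
move=> /height_columnP hc hnb hi0.
pose C i := all (fun a : column s => a i == c i - sg b) nb.
have C0 : C i0 by apply/allP => a /hi0 /eqP.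
(* The factor [sg b] turns the maximum into a minimum when [b] is false. *)
case: (arg_maxP (fun i => sg b * c i) C0) => i Ci imax.
exists i; apply/andP; split=> //; apply/forallP => j; apply/implyP => /eqP ij.
case: (eqVneq (c j) (c i - sg b)) => // cj.
have {}cj : c j = c i + sg b.
  by move: cj (hc _ _ ij); rewrite /sg; case: b {hi0 C C0 Ci imax}; lia.
have /imax : C j.
  apply/allP => a anb; have [/height_columnP ha hac] := hnb a anb.
  move/allP: Ci => /(_ a anb) /eqP ai; apply/eqP.
  by move: ai (ha _ _ ij) (hac j) cj; rewrite /sg; case: b {hi0 C C0 imax}; lia.
by rewrite cj /sg; case: b {hi0 C C0 Ci imax cj}; lia.
Qed.

Lemma sg_of {s} (a c : column s) i :
  `|a i - c i| = 1 -> exists b, a i = c i - sg b.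
Proof.
move=> h; case: (eqVneq (a i) (c i - 1)) => [->|ne]; first by exists true.
by exists false; rewrite /sg; move: h ne; lia.
Qed.

Lemma extremal_count_gt0 s b nb (c : column s) i :
  extremal b nb c i -> (0 < extrema_count nb c)%N.
Proof.
move=> h; apply/card_gt0P; exists i; rewrite inE;
by case: b h => ->; rewrite ?orbT.
Qed.

Lemma side_count_gt0 s (a c : column s) :
  height_column c -> compatible a c -> (0 < extrema_count [:: a] c)%N.
Proof.
move=> hc hac; have [b hb] := sg_of (hac.2 ord0).
have [||i] := @extremal_exists _ b [:: a] c ord0 hc.
- by move=> a'; rewrite inE => /eqP ->.
- by move=> a'; rewrite inE => /eqP ->.
- exact: extremal_count_gt0.
Qed.

(** Two rows with opposite signs towards the side column start two climbs, one
to a maximum and one to a minimum; these are distinct cells. *)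
Lemma side_count_gt1 s (a c : column s) i j :
  height_column c -> compatible a c -> a i - c i != a j - c j ->
  (1 < extrema_count [:: a] c)%N.
Proof.
move=> hc hac; wlog aij : i j / a i - c i < a j - c j.
  move=> IH ne; move: (ne); rewrite neq_lt => /orP [] lt; first exact: (IH i j).
  by apply: (IH j i) => //; rewrite eq_sym.
move=> _.
have hnb a' : a' \in [:: a] -> compatible a' c by rewrite inE => /eqP ->.
have [|x hx] := @extremal_exists _ true [:: a] c i hc hnb.
  move=> a'; rewrite inE => /eqP ->.
  by move: (hac.2 i) (hac.2 j); rewrite /sg; lia.
have [|y hy] := @extremal_exists _ false [:: a] c j hc hnb.
  move=> a'; rewrite inE => /eqP ->.
  by move: (hac.2 i) (hac.2 j); rewrite /sg; lia.
apply/card_gt1P; exists x, y; split; rewrite ?inE ?hx ?hy ?orbT //.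
apply: contraTneq hx => ->; rewrite /extremal /= andbT negb_and.
move: hy => /andP [_ /=]; rewrite andbT => /eqP ->.
by apply/orP; right; rewrite /sg; lia.
Qed.

(** If [e'] and [e] differ in some row, then [c] is above both side columns or
below both of them in that row, so [extremal_exists] yields an extremum.  If
they are equal but change between two consecutive rows, then from [l] to [c]
and again from [c] to [step c e'] the height difference of these rows moves by
2 in the same direction, which is impossible within {-1, 1}. *)
Lemma interior_count_gt0 s (l c : column s) (e : signs s) :
  height_column c -> height_column l -> c = step l e ->
  forall e', height_column (step c e') ->
    extrema_count [:: step c e'; l] c = 0%N ->
  e' = e /\ constant_signs e.
Proof.
move=> hc hl def_c e' hr cnt0.
have lc : compatible l c by rewrite def_c; apply: compatible_step.
have rc : compatible (step c e') c by apply: compatible_step_r.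
have ee : e' = e.
  apply/ffunP => i; apply/eqP; case: (eqVneq (e' i) (e i)) => // ne.
  have [||x] := @extremal_exists _ (e i) [:: step c e'; l] c i hc.
  - by move=> a; rewrite !inE => /orP [] /eqP ->.
  - move=> a; rewrite !inE => /orP [] /eqP ->; last first.
      by rewrite def_c ffunE addrK.
    by rewrite ffunE; case: (e i) (e' i) ne => -[].
  - by move/extremal_count_gt0; rewrite cnt0.
split=> //; subst e'.
suff h k (i : 'I_s.+1) : i = k :> nat -> e i = e ord0.
  by apply/eqP/ffunP => i; rewrite ffunE; apply: h.
elim: k i => [|k IH] i ik; first by congr (e _); apply: val_inj.
have ks : (k < s.+1)%N by have := ltn_ord i; lia.
rewrite -(IH (Ordinal ks) erefl).
have ij : `|(i : nat) - (Ordinal ks : nat)|%N = 1%N by rewrite /=; lia.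
move/height_columnP: hl => /(_ _ _ ij); move/height_columnP: hr => /(_ _ _ ij).
rewrite def_c !ffunE /sg.
by case: (e i); case: (e _) => //; lia.
Qed.

Lemma constant_count0 s (l : column s) (e : signs s) :
  extrema_count [:: step (step l e) e; l] (step l e) = 0%N.
Proof.
apply/eqP; rewrite cards_eq0; apply/eqP/setP => i.
rewrite !inE /extremal /= !ffunE.
apply/negbTE; rewrite !andbT negb_or !negb_and.
by case: (e i); rewrite /sg; apply/andP; split; apply/orP; right; lia.
Qed.

(** * Counting continuations column by column *)

Fixpoint height_columns s (c : column s) (t : seq (signs s)) : bool :=
  height_column c &&
  if t is e :: t' then height_columns (step c e) t' else true.

Fixpoint total_extrema s (l : seq (column s)) (c : column s)
    (t : seq (signs s)) : nat :=
  if t is e :: t' then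
    (extrema_count (step c e :: l) c + total_extrema [:: c] (step c e) t')%N
  else extrema_count l c.

(** The column [c] is the last one placed so far, [l] holds the column before
it (if any), and [r] is the number of extrema in [c] and the [k] columns still
to come. *)
Definition continuations s (l : seq (column s)) (c : column s)
    (r k : nat) : nat :=
  #|[set t : k.-tuple (signs s) |
       height_columns c t && (total_extrema l c t == r)]%SET|.

Lemma continuations0 s (l : seq (column s)) c r :
  continuations l c r 0 = height_column c && (extrema_count l c == r).
Proof.
rewrite /continuations -sum1dep_card (eq_bigl (fun t => (t == [tuple]) &&
  (height_column c && (extrema_count l c == r)))); last first.
  by move=> t; rewrite [t]tuple0 eqxx /= andbT.
case: (_ && (_ == r)).
  by rewrite (eq_bigl (pred1 [tuple])) ?big_pred1_eq // => t; rewrite andbT.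
by rewrite big_pred0 // => t; rewrite andbF.
Qed.

(** The part of [continuations l c r k.+1] in which the next column is
[step c e]. *)
Definition continuations_via s (l : seq (column s)) (c : column s) (r : nat)
    (e : signs s) (k : nat) : nat :=
  if (extrema_count (step c e :: l) c <= r)%N then
    continuations [:: c] (step c e) (r - extrema_count (step c e :: l) c) k
  else 0%N.

Lemma continuationsS s (l : seq (column s)) c r k : height_column c ->
  continuations l c r k.+1 = (\sum_e continuations_via l c r e k)%N.
Proof.
move=> hc; rewrite /continuations -sum1dep_card.
pose cons_tuple (x : signs s * k.-tuple (signs s)) : k.+1.-tuple (signs s) :=
  [tuple of x.1 :: x.2].
(* Split off the first sign vector of each tuple. *)
rewrite (reindex cons_tuple) /=; last first.
  exists (fun t => (thead t, [tuple of behead t])) => [[e t] _|t _].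
    by congr (_, _); apply: val_inj.
  by rewrite [t in RHS]tuple_eta /cons_tuple /=; apply: val_inj.
rewrite -(pair_big_dep xpredT (fun e (t : k.-tuple _) => height_column c &&
  height_columns (step c e) t && (extrema_count (step c e :: l) c
   + total_extrema [:: c] (step c e) t == r)%N) (fun _ _ => 1%N)) /=.
apply: eq_bigr => e _; rewrite /continuations_via hc /= sum1dep_card.
case: leqP => h.
  apply: eq_card => t; rewrite !inE; congr (_ && _).
  by move: (extrema_count _ _) (total_extrema _ _ _) h; lia.
apply: eq_card0 => t; rewrite !inE; apply/negbTE.
rewrite negb_and; apply/orP; right.
by move: (extrema_count _ _) (total_extrema _ _ _) h; lia.
Qed.

Lemma continuations_invalid s (l : seq (column s)) c r k :
  ~~ height_column c -> continuations l c r k = 0%N.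
Proof.
by move=> hc; apply: eq_card0 => t; rewrite !inE; case: (tval t) => [|e t'] /=;
   rewrite (negbTE hc).
Qed.

Definition translate s (a : int) (c : column s) : column s :=
  [ffun i => c i + a].

Lemma height_column_translate s a (c : column s) :
  height_column (translate a c) = height_column c.
Proof.
apply: eq_forallb => i; apply: eq_forallb => j; congr (_ ==> _).
by rewrite !ffunE; congr (`|_| == _); lia.
Qed.

Lemma step_translate s a (c : column s) e :
  step (translate a c) e = translate a (step c e).
Proof. by apply/ffunP => i; rewrite !ffunE addrAC. Qed.

Lemma extrema_count_translate s a l (c : column s) :
  extrema_count (map (translate a) l) (translate a c) = extrema_count l c.
Proof.
have h b i : extremal b (map (translate a) l) (translate a c) i =
    extremal b l c i.
  rewrite /extremal all_map; congr (_ && _).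
    by apply: eq_forallb => j; rewrite !ffunE addrAC (inj_eq (addIr _)).
  by apply: eq_all => d /=; rewrite !ffunE addrAC (inj_eq (addIr _)).
by apply: eq_card => i; rewrite !inE !h.
Qed.

Lemma continuations_translate s a l (c : column s) r k :
  continuations (map (translate a) l) (translate a c) r k =
  continuations l c r k.
Proof.
elim: k l c r => [|k IH] l c r.
  by rewrite !continuations0 height_column_translate extrema_count_translate.
case: (boolP (height_column c)) => hc; last first.
  by rewrite !continuations_invalid ?height_column_translate.
rewrite !continuationsS ?height_column_translate //; apply: eq_bigr => e _.
rewrite /continuations_via step_translate -map_cons extrema_count_translate.
by rewrite -(IH [:: c]).
Qed.

(** For constant [e] the next pair of columns is a translate of the present
one. *)
Lemma continuations_constant s (c : column s) e r k : constant_signs e ->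
  continuations [:: step c e] (step (step c e) e) r k =
  continuations [:: c] (step c e) r k.
Proof.
move=> /eqP ce; have def_step d : step d e = translate (sg (e ord0)) d.
  by apply/ffunP => i; rewrite !ffunE {1}ce ffunE.
rewrite def_step -(continuations_translate (sg (e ord0)) [:: c]) /=.
by rewrite -!def_step.
Qed.

Lemma not_constant s (e : signs s) :
  ~~ constant_signs e -> exists i, e i != e ord0.
Proof.
move=> ne; apply/existsP; apply: contraNT ne; rewrite negb_exists => /forallP h.
by apply/eqP/ffunP => i; rewrite ffunE; apply/eqP; rewrite -[_ == _]negbK.
Qed.

Lemma side_count_nonconstant s (c : column s) (e : signs s) l :
  height_column c -> compatible l c ->
  (forall i, l i - c i = sg (e i)) \/ (forall i, c i - l i = sg (e i)) ->
  ((~~ constant_signs e).+1 <= extrema_count [:: l] c)%N.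
Proof.
move=> hc lc he.
case: (boolP (constant_signs e)) => [_|/not_constant [i ne]] /=.
  exact: side_count_gt0.
apply: (side_count_gt1 (i := i) (j := ord0)) => //; move: ne.
case: he => he; have := he i; have := he ord0;
  by case: (e i); case: (e ord0) => //; rewrite /sg; lia.
Qed.

(** * Eventual polynomiality *)

(** The last column always contributes an extremum.  If [e] is not constant, a
second one comes from the last column itself when nothing follows, and
otherwise from the column [step c e], by [interior_count_gt0]. *)
Lemma total_extrema_ge s (c : column s) e t :
  height_column c -> height_columns (step c e) t ->
  ((~~ constant_signs e).+1 <= total_extrema [:: c] (step c e) t)%N.
Proof.
elim: t c e => [|e' t IH] c e hc /=.
  rewrite andbT => hs; apply: side_count_nonconstant => //.
    exact: compatible_step.
  by right => i; rewrite ffunE; lia.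
move=> /andP [hs ht].
have ge1 := IH _ _ hs ht.
case: (posnP (extrema_count [:: step (step c e) e'; c] (step c e))) => h0;
  last first.
  by move: h0 ge1; case: (constant_signs _) => /=; lia.
have hs' : height_column (step (step c e) e').
  by case: t ht {ge1 IH} => [|? ?] /= /andP [].
have [def_e' ->] := interior_count_gt0 hs hc erefl hs' h0.
by move: ge1 => /=; lia.
Qed.

Lemma continuations_small s (c : column s) e r k :
  height_column c -> (r <= ~~ constant_signs e)%N ->
  continuations [:: c] (step c e) r k = 0%N.
Proof.
move=> hc hr; apply: eq_card0 => t; rewrite !inE; apply/negbTE.
apply/negP => /andP [ht /eqP def_r]; have := total_extrema_ge hc ht.
by rewrite def_r; lia.
Qed.

(** Thresholds are truncated at 0.  For non-constant [e] the recursion does not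
reach [k] = 0, which is in the claimed range only for [r <= 1], where the count
vanishes ([continuations_small]).  All terms of the recursion other than
the continuation of a constant [e] by itself put an extremum into [step c e],
so that they have smaller [r]. *)
Lemma continuations_polynomial s r (c : column s) e : height_column c ->
  polynomial_from (r - (constant_signs e).+1)
    (continuations [:: c] (step c e) r).
Proof.
elim/ltn_ind: r c e => r IH c e hc.
case: (leqP r (~~ constant_signs e)) => [rs|r_gt].
  by apply: polynomial_from0 => k; apply: continuations_small.
case: (boolP (height_column (step c e))) => hs; last first.
  by apply: polynomial_from0 => k; apply: continuations_invalid.
have via_poly e' : (e' != e) || ~~ constant_signs e ->
    polynomial_from (r - 2) (continuations_via [:: c] (step c e) r e').
  move=> he'; rewrite /continuations_via.
  case: leqP => hr; last exact: polynomial_from0.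
  case: (boolP (height_column (step (step c e) e'))) => hs'; last first.
    by apply: polynomial_from0 => k; apply: continuations_invalid.
  have cnt : (0 < extrema_count [:: step (step c e) e'; c] (step c e))%N.
    rewrite lt0n; apply: contraL he' => /eqP h0.
    by have [-> ->] := interior_count_gt0 hs hc erefl hs' h0; rewrite eqxx.
  move: (extrema_count _ _) hr cnt => w hr cnt.
  apply: polynomial_from_le (IH (r - w)%N _ (step c e) e' hs); last lia.
  by case: (constant_signs e'); lia.
case: (boolP (constant_signs e)) r_gt via_poly => ce r_gt via_poly.
  apply: (polynomial_from_antidifference (g := fun k => \sum_(e' | e' != e)
     continuations_via [:: c] (step c e) r e' k)%N).
    move=> k; rewrite continuationsS // (bigD1 e) //=; congr (_ + _)%N.
    by rewrite /continuations_via constant_count0 subn0 continuations_constant.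
  by apply: polynomial_from_sum => e' ne; apply: via_poly; rewrite ne.
have -> : (r - 1 = (r - 2).+1)%N by move: r_gt => /=; lia.
apply: polynomial_from_shift => [k|]; first exact: continuationsS.
by apply: polynomial_from_sum => e' _; apply: via_poly; rewrite orbT.
Qed.

(** The thresholds of [continuations_polynomial] and the lower bounds of
[side_count_nonconstant] compensate each other: a non-constant [e] costs one
more extremum, and its threshold relative to [r] is larger by one. *)
Lemma initial_polynomial s d (c : column s) : (3 <= d)%N ->
  polynomial_from (d - 2) (continuations [::] c d).
Proof.
move=> d3; case: (boolP (height_column c)) => hc; last first.
  by apply: polynomial_from0 => k; apply: continuations_invalid.
have -> : (d - 2 = (d - 3).+1)%N by lia.
apply: polynomial_from_shift => [k|]; first exact: continuationsS.
apply: polynomial_from_sum => e _; rewrite /continuations_via.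
case: leqP => hd; last exact: polynomial_from0.
case: (boolP (height_column (step c e))) => hs; last first.
  by apply: polynomial_from0 => k; apply: continuations_invalid.
have cnt : ((~~ constant_signs e).+1 <= extrema_count [:: step c e] c)%N.
  apply: side_count_nonconstant => //; first exact: compatible_step_r.
  by left=> i; rewrite ffunE; lia.
apply: polynomial_from_le (continuations_polynomial _ _ hc).
by move: cnt; case: (constant_signs e) => /=; lia.
Qed.

(** * From height functions to sequences of columns *)

Fixpoint column_at s (c : column s) (t : seq (signs s)) (j : nat) : column s :=
  match t, j with
  | e :: t', j'.+1 => column_at (step c e) t' j'
  | _, _ => c
  end.

Lemma column_at0 s (c : column s) t : column_at c t 0 = c.
Proof. by case: t. Qed.

Lemma column_atS s (c : column s) t j e0 : (j < size t)%N ->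
  column_at c t j.+1 = step (column_at c t j) (nth e0 t j).
Proof.
elim: t c j => [//|e t IH] c [_|j jt]; first by rewrite /= column_at0.
exact: IH.
Qed.

Lemma height_columnsP s (c : column s) t :
  reflect (forall j, (j < (size t).+1)%N -> height_column (column_at c t j))
    (height_columns c t).
Proof.
elim: t c => [|e t IH] c /=.
  by rewrite andbT; apply: (iffP idP) => [h j _ //|h]; exact: (h 0%N).
apply: (iffP andP) => [[hc /IH ht] [//|j]|h]; first exact: ht.
by split; [exact: (h 0%N) | apply/IH => j jt; exact: (h j.+1)].
Qed.

Definition side_columns s (l : seq (column s)) (c : column s) t (j : nat) :=
  (if (j < size t)%N then [:: column_at c t j.+1] else [::]) ++
  (if j is j'.+1 then [:: column_at c t j'] else l).

Lemma total_extremaE s (l : seq (column s)) (c : column s) t :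
  total_extrema l c t =
  (\sum_(j < (size t).+1)
     extrema_count (side_columns l c t j) (column_at c t j))%N.
Proof.
elim: t l c => [|e t IH] l c; first by rewrite big_ord_recl big_ord0 addn0.
rewrite big_ord_recl /= IH; congr addn.
  by rewrite /side_columns /= column_at0.
by apply: eq_bigr => -[[|j] /= jt] _; rewrite /side_columns /= ?column_at0.
Qed.

Definition grid_of s k (c : column s) (t : seq (signs s)) :
    {ffun cell s.+1 k.+1 -> int} :=
  [ffun u : cell s.+1 k.+1 => column_at c t u.2 u.1].

Lemma extremal_grid s k (c : column s) (t : k.-tuple (signs s)) b i
    (j : 'I_k.+1) :
  [forall v : cell s.+1 k.+1, adjacent (i, j) v ==>
     (grid_of k c t v == grid_of k c t (i, j) - sg b)] =
  extremal b (side_columns [::] c t j) (column_at c t j) i.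
Proof.
apply/forallP/andP => [h|[/forallP hv /allP hs] [i' j']].
  split.
    apply/forallP => i'; apply/implyP => ii'; have := h (i', j).
    by rewrite !ffunE /adjacent /= eqxx ii' orbT.
  apply/allP => a; rewrite mem_cat size_tuple.
  have side j' : (j' < k.+1)%N -> `|(j : nat) - j'|%N == 1%N ->
      column_at c t j' i == column_at c t j i - sg b.
    move=> jk jj'; have := h (i, Ordinal jk).
    by rewrite !ffunE /adjacent /= eqxx jj'.
  move=> /orP [].
    by case: ifP => // jk; rewrite inE => /eqP ->; apply: side; lia.
  case: (j : nat) (ltn_ord j) side => // j' jk side.
  by rewrite inE => /eqP ->; apply: side; lia.
apply/implyP; rewrite /adjacent /= !ffunE /=.
move=> /orP [] /andP [/eqP <- d1]; last first.
  exact: (implyP (hv i')).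
apply: hs; rewrite mem_cat size_tuple.
case: (ltnP j j') => jj'.
  have -> : (j' : nat) = j.+1 by lia.
  by rewrite (_ : j < k)%N ?inE ?eqxx //; have := ltn_ord j'; lia.
have -> : (j : nat) = j'.+1 by lia.
by rewrite [X in _ || X]inE eqxx orbT.
Qed.

Lemma card_extrema_grid s k (c : column s) (t : k.-tuple (signs s)) :
  #|extrema (grid_of k c t)| = total_extrema [::] c t.
Proof.
rewrite total_extremaE size_tuple -sum1_card.
pose P i (j : 'I_k.+1) :=
  extremal true (side_columns [::] c t j) (column_at c t j) i
  || extremal false (side_columns [::] c t j) (column_at c t j) i.
rewrite (eq_bigl (fun u => true && P u.1 u.2)); last first.
  move=> [i j]; rewrite inE /P -!extremal_grid orbC /=.
  by congr (_ || _); apply: eq_forallb => v; rewrite /= ?opprK.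
rewrite -(pair_big_dep xpredT (fun i j => P i j) (fun _ _ => 1%N)) /=.
rewrite (exchange_big_dep xpredT) //=; apply: eq_bigr => j _.
by rewrite sum1dep_card.
Qed.

Lemma is_height_grid s k (c : column s) (t : k.-tuple (signs s)) :
  is_height (grid_of k c t) <-> height_columns c t /\ c ord0 = 0.
Proof.
split=> [[hadj h0]|[/height_columnsP ht c0]].
  split; last first.
    by have := h0 (ord0, ord0) erefl erefl; rewrite ffunE /= column_at0.
  apply/height_columnsP => j; rewrite size_tuple => jk.
  apply/height_columnP => i i' ii'.
  have := hadj (i, Ordinal jk) (i', Ordinal jk); rewrite !ffunE /=; apply.
  by rewrite /adjacent /= eqxx ii' orbT.
have hstep j i : (j < k)%N -> `|column_at c t j.+1 i - column_at c t j i| = 1.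
  move=> jk; rewrite (@column_atS _ _ _ _ [ffun=> true]) ?size_tuple // ffunE.
  by rewrite /sg; case: ifP => _; lia.
split=> [[i j] [i' j']|[i j] /= i0 j0]; last first.
  rewrite ffunE /= j0 column_at0 -c0; congr (c _); exact: val_inj.
rewrite /adjacent !ffunE /= => /orP [] /andP [/eqP <- /eqP d1]; last first.
  have jk : (j < (size t).+1)%N by rewrite size_tuple.
  by move/height_columnP: (ht _ jk); apply.
case: (ltnP j j') => jj'.
  have -> : (j' : nat) = j.+1 by lia.
  by rewrite distrC hstep //; have := ltn_ord j'; lia.
have -> : (j : nat) = j'.+1 by lia.
by rewrite hstep //; have := ltn_ord j; lia.
Qed.

Lemma grid_of_inj s k (c c' : column s) (t t' : k.-tuple (signs s)) :
  grid_of k c t = grid_of k c' t' -> c = c' /\ t = t'.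
Proof.
move=> /ffunP eq_g.
have eq_col j : (j < k.+1)%N -> column_at c t j = column_at c' t' j.
  by move=> jk; apply/ffunP => i; have := eq_g (i, Ordinal jk); rewrite !ffunE.
split; first by have := eq_col 0%N isT; rewrite !column_at0.
apply: eq_from_tnth => j; apply/ffunP => i.
have e0 : signs s := [ffun=> true].
have j1 : (j.+1 < k.+1)%N by rewrite ltnS.
have := eq_col _ j1; rewrite !(column_atS _ e0) ?size_tuple //.
rewrite eq_col; last exact: ltnW.
move=> /ffunP /(_ i); rewrite !ffunE -!tnth_nth => /addrI.
by case: (tnth t j i); case: (tnth t' j i).
Qed.

(** Codes for the possible first columns: as they start at 0, their values lie
between -s and s, so they form a finite type. *)
Definition column_of_code s (x : {ffun 'I_s.+1 -> 'I_(s + s).+1}) : column s :=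
  [ffun i => (x i : nat)%:Z - s%:Z].

Lemma grid_of_surj s k (h : {ffun cell s.+1 k.+1 -> int}) : is_height h ->
  exists x (t : k.-tuple (signs s)), grid_of k (column_of_code x) t = h.
Proof.
move=> hh; have [hadj _] := hh.
exists [ffun i => inord (absz (h (i, ord0) + s%:Z))].
pose e j : signs s := [ffun i => h (i, inord j.+1) == h (i, inord j) + 1].
exists [tuple of mkseq e k]; set c := column_of_code _.
suff col j : (j < k.+1)%N -> forall i,
    column_at c (mkseq e k) j i = h (i, inord j).
  by apply/ffunP => -[i j]; rewrite ffunE /= col // inord_val.
elim: j => [_|j IH jk] i.
  have -> : inord 0 = ord0 :> 'I_k.+1 by apply: val_inj; rewrite /= inordK.
  rewrite column_at0 !ffunE; have := is_height_bound (i, ord0) hh.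
  rewrite /= addn0; have := ltn_ord i; move: (h _) => a ia hb.
  by rewrite inordK; lia.
rewrite (@column_atS _ _ _ _ (e 0%N)) ?size_mkseq // ffunE IH; last exact: ltnW.
rewrite nth_mkseq // ffunE.
have := hadj (i, inord j.+1) (i, inord j).
have -> : adjacent (i, inord j.+1 : 'I_k.+1) (i, inord j).
  by rewrite /adjacent /= eqxx !inordK //; first lia; exact: ltnW.
move=> /(_ isT); move: (h _) (h _) => a b; rewrite /sg; case: eqP; lia.
Qed.

Lemma mem_heights d m n (h : {ffun cell m n -> int}) :
  h \in fset_set [set h : {ffun cell m n -> int} |
                  is_height h /\ #|extrema h| = d]%classic
  <-> is_height h /\ #|extrema h| = d.
Proof.
rewrite in_fset_set ?inE //.
by apply: sub_finite_set (@finite_heights m n) => f [].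
Qed.

Lemma E_continuations d s k :
  E d s.+1 k.+1 =
  (\sum_(x : {ffun 'I_s.+1 -> 'I_(s + s).+1} | column_of_code x ord0 == 0)
     continuations [::] (column_of_code x) d k)%N.
Proof.
pose code := ({ffun 'I_s.+1 -> 'I_(s + s).+1} * k.-tuple (signs s))%type.
pose good (y : code) := (column_of_code y.1 ord0 == 0) &&
  (height_columns (column_of_code y.1) y.2 &&
   (total_extrema [::] (column_of_code y.1) y.2 == d)).
pose g (y : code) := grid_of k (column_of_code y.1) y.2.
have g_inj : injective g.
  move=> [x t] [x' t'] /grid_of_inj [/= /ffunP eq_x ->]; congr (_, _).
  apply/ffunP => i; apply: val_inj; have := eq_x i.
  by rewrite !ffunE => /addIr [].
transitivity #|` [fset g y | y in [pred y | good y]]%fset|.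
  rewrite /E; congr #|` _|; apply/fsetP => h.
  apply/idP/imfsetP => [/mem_heights [hh hd]|[[x t]]].
    have [x [t def_h]] := grid_of_surj hh.
    exists (x, t) => //=; move: hh hd; rewrite -def_h card_extrema_grid.
    move=> /is_height_grid [hc c0] hd.
    by apply/and3P; split; [apply/eqP | | apply/eqP].
  move=> /and3P [/eqP c0 hc /eqP hd] ->; apply/mem_heights.
  by split; [apply/is_height_grid | rewrite card_extrema_grid].
rewrite card_imfset //=.
transitivity #|[pred y | good y]|.
  by rewrite cardE.
rewrite -sum1_card -(pair_big_dep (fun x => column_of_code x ord0 == 0)
  (fun x (t : k.-tuple (signs s)) => height_columns (column_of_code x) t &&
   (total_extrema [::] (column_of_code x) t == d)) (fun _ _ => 1%N)) /=.
by apply: eq_bigr => x _; rewrite sum1dep_card.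
Qed.

Lemma E_polynomial d s : (3 <= d)%N -> polynomial_from d.-1 (E d s.+1).
Proof.
move=> d3; have -> : d.-1 = (d - 2).+1 by lia.
apply: polynomial_from_shift => [k|]; first exact: E_continuations.
by apply: polynomial_from_sum => x _; apply: initial_polynomial.
Qed.

(** * Symmetry and conclusion *)

Definition transpose m n (h : {ffun cell m n -> int}) :
    {ffun cell n m -> int} :=
  [ffun u : cell n m => h (u.2, u.1)].

Lemma transposeK m n : cancel (@transpose m n) (@transpose n m).
Proof. by move=> h; apply/ffunP => -[i j]; rewrite !ffunE. Qed.

Lemma adjacent_swap m n (u v : cell m n) :
  adjacent (u.2, u.1) (v.2, v.1) = adjacent u v.
Proof. by rewrite /adjacent orbC. Qed.

Lemma is_height_transpose m n (h : {ffun cell m n -> int}) :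
  is_height h -> is_height (transpose h).
Proof.
move=> [hadj h0]; split=> [u v uv|u u1 u2]; rewrite !ffunE; last exact: h0.
by apply: hadj; rewrite adjacent_swap.
Qed.

Lemma extrema_transpose m n (h : {ffun cell m n -> int}) :
  #|extrema (transpose h)| = #|extrema h|.
Proof.
pose sw (u : cell n m) : cell m n := (u.2, u.1).
have sw_inj : injective sw by move=> [a b] [a' b'] [-> ->].
rewrite -[RHS](on_card_preimset (f := sw)); last first.
  by exists (fun u => (u.2, u.1)) => -[].
apply: eq_card => u; rewrite !inE.
congr (_ || _); apply/forallP/forallP => H v.
- by have := H (v.2, v.1); rewrite !ffunE -adjacent_swap /sw /=; case: v.
- by have := H (sw v); rewrite !ffunE adjacent_swap.
- by have := H (v.2, v.1); rewrite !ffunE -adjacent_swap /sw /=; case: v.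
- by have := H (sw v); rewrite !ffunE adjacent_swap.
Qed.

Lemma E_sym d m n : E d m n = E d n m.
Proof.
rewrite /E; set A := fset_set [set h : {ffun cell n m -> int} | _].
transitivity #|` [fset transpose h | h in A]%fset|; last first.
  by rewrite card_imfset //; exact: can_inj (@transposeK n m).
rewrite {}/A; congr #|` _|; apply/fsetP => h; apply/idP/imfsetP => [|[f]].
  move=> /mem_heights [hh ch]; exists (transpose h); last by rewrite transposeK.
  apply/mem_heights.
  by split; [exact: is_height_transpose | rewrite extrema_transpose].
move=> /mem_heights [hf cf] ->; apply/mem_heights.
by split; [exact: is_height_transpose | rewrite extrema_transpose].
Qed.

Lemma poly_eq_from (P Q : {poly rat}) a :
  (forall n : nat, (a <= n)%N -> P.[n%:R] = Q.[n%:R]) -> P = Q.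
Proof.
move=> h; apply/eqP; rewrite -subr_eq0; apply/eqP.
apply: (@roots_geq_poly_eq0 _ _ [seq n%:R | n <- iota a (size (P - Q))]).
- apply/allP => x /mapP [n]; rewrite mem_iota => /andP [an _] ->.
  by rewrite rootE hornerD hornerN h // subrr.
- rewrite map_inj_uniq ?iota_uniq // => x y /eqP.
  by rewrite eqr_nat => /eqP.
- by rewrite size_map size_iota.
Qed.

Theorem proposition11p8 (d : nat) (hd : (4 <= d)%N)
    (p : {poly {poly rat}}) (hp : is_p d p)
    (s : nat) (hs : (1 <= s < d.-1)%N) :
  exists B : {poly rat}, forall m n : nat,
    (1 <= m)%N -> (1 <= n)%N ->
    minn m n = s -> (d.-1 <= maxn m n)%N ->
    (E d m n)%:R - p.[m%:R, n%:R] = B.[(maxn m n)%:R].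
Proof.
have d1 : maxn d.-1 2 = d.-1 by lia.
have [Q hQ] : polynomial_from d.-1 (E d s).
  by case: s hs => // s' _; apply: E_polynomial; lia.
(* Both sides are polynomials in the coordinate [s]; by the symmetry of the
   counts they agree when that coordinate is large. *)
have p_sym m : (d.-1 <= m)%N -> p.[m%:R, s%:R] = p.[s%:R, m%:R].
  move=> dm; rewrite -[RHS]horner2_swapXY; congr _.[_].
  apply: (@poly_eq_from _ _ d.-1) => n dn.
  by rewrite horner2_swapXY !hp ?d1 // E_sym.
exists (Q - p.[s%:R%:P]) => m n m1 n1.
rewrite hornerD hornerN; case: (leqP m n) => mn.
  by move=> -> dn; rewrite hQ.
by move=> -> dm; rewrite E_sym hQ // p_sym.
Qed.
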